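(* Let $G$ be a connected graph that contains a cycle, with girth $g(G) \ge 7$. Then the following statements are equivalent. (i) $\mathrm{DOM}_t(G)=g(G)$ or $\mathrm{dom}_t(G)=g(G)$; (ii) $\mathrm{DOM}_t(G)=\mathrm{dom}_t(G)=g(G)$; (iii) $G$ is unicyclic and $G$ is obtained from a cycle by appending any number of leaves to each vertex of the cycle.
   Context: All graphs are finite and simple. An orientation of a graph $G$ is a digraft obtained by directing each edge $uv$ of $G$ in exactly one of the two directions $(u,v)$ or $(v,u)$ (that is, a digraph on $V(G)$ with exactly one arc for each edge). The orientation is valid if every vertex has in-degree at least $1$. A set $S\subseteq V(D)$ is a total dominating set of a digraph $D$ if every vertex of $D$ (including those in $S$) has an in-neighbor in $S$; $\gamma_t(D)$ is the minimum cardinality of a total dominating set of $D$. For a graph $G$ in which every component contains a cycle (equivalently, $G$ has a valid orientation), $\mathrm{DOM}_t(G)$ (respectively $\mathrm{dom}_t(G)$) is the maximum (respectively minimum) of $\gamma_t(D)$ over all valid orientations $D$ of $G$. The girth $g(G)$ is the number of vertices of a shortest cycle of $G$. A graph is unicyclic if it contains exactly one cycle. Appending a leaf to a vertex $v$ means adding a new vertex adjacent only to $v$; ''any number'' includes zero, and the number may vary from vertex to vertex. *)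

(* Defs.v *)
From mathcomp Require Import all_boot.

Set Implicit Arguments.
Unset Strict Implicit.
Unset Printing Implicit Defensive.

(* A finite simple graph is a symmetric irreflexive relation [e] on a finType;
   a digraph on the same vertices is its set of arcs, [(u, v)] being the arc
   from [u] to [v]. *)

Section Graph.

Variables (T : finType) (e : rel T).

Definition connected_graph : Prop := forall x y : T, connect e x y.

Definition graph_cycle (c : seq T) : bool := (2 < size c) && ucycleb e c.

Definition has_graph_cycle : Prop := exists c : seq T, graph_cycle c.

(* The neutral element #|T| does not affect the minimum when the graph has a
   cycle, since no cycle is longer than #|T|; without a cycle the value is
   meaningless. *)
Definition girth : nat :=
  \big[minn/#|T|]_(k < #|T|.+1 | [exists c : k.-tuple T, graph_cycle c]) k.

Definition cycle_edges (c : seq T) : {set {set T}} :=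
  [set [set x; next c x] | x in c].

(* Cycles are counted as subgraphs: sequences that differ by a rotation or a
   reversal have the same edges and are the same cycle. *)
Definition unicyclic : Prop :=
  exists! E : {set {set T}}, exists2 c : seq T, graph_cycle c & E = cycle_edges c.

Definition orientation (D : {set T * T}) : bool :=
  [forall u, forall v,
    if e u v then ((u, v) \in D) (+) ((v, u) \in D) else (u, v) \notin D].

Definition valid_orientation (D : {set T * T}) : bool :=
  orientation D && [forall v, exists u, (u, v) \in D].

Definition total_dominating (D : {set T * T}) (S : {set T}) : bool :=
  [forall v, exists u in S, (u, v) \in D].

(* As for [girth], #|T| bounds every #|S|; a total dominating set exists as soon
   as all in-degrees are positive. *)
Definition gamma_t (D : {set T * T}) : nat :=
  \big[minn/#|T|]_(S : {set T} | total_dominating D S) #|S|.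

Definition DOM_t : nat :=
  \max_(D : {set T * T} | valid_orientation D) gamma_t D.

(* #|T| bounds every [gamma_t D]. *)
Definition dom_t : nat :=
  \big[minn/#|T|]_(D : {set T * T} | valid_orientation D) gamma_t D.

End Graph.

Definition graph_iso (T1 T2 : finType) (e1 : rel T1) (e2 : rel T2) : Prop :=
  exists2 f : T1 -> T2, bijective f & {mono f : x y / e1 x y >-> e2 x y}.

(* The cycle on n vertices, for n >= 3. *)
Definition cycle_graph (n : nat) : rel 'I_n :=
  fun i j => (j == ordS i) || (i == ordS j).

(* [inr (Tagged _ i)] with tag [v] is the [i]-th of the [l v] leaves appended
   to [v]. *)
Definition append_leaves (T : finType) (e : rel T) (l : T -> nat) :
    rel (T + {v : T & 'I_(l v)})%type :=
  fun x y => match x, y with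
  | inl u, inl v => e u v
  | inl u, inr w => u == tag w
  | inr w, inl u => u == tag w
  | inr _, inr _ => false
  end.

Arguments append_leaves {T} e l _ _.

Definition cycle_with_leaves (T : finType) (e : rel T) : Prop :=
  exists n : nat, 2 < n /\
  exists l : 'I_n -> nat, graph_iso e (append_leaves (@cycle_graph n) l).

(* Main.v *)
Require Import Defs.
From mathcomp Require Import all_boot zify.

(** Choosing for every vertex one in-neighbour inside a total dominating set
    [S] of an orientation gives a self-map of the vertices with image in [S].
    Such a map has a cyclic orbit, and the orbit is a cycle of the graph because
    an orientation has no loop and no pair of opposite arcs.  So [S] contains a
    cycle ([total_dominating_cycle]), hence has at least [girth] elements; when
    it has exactly [girth] elements it is the vertex set of a shortest cycle.
    Therefore, as soon as [DOM_t] or [dom_t] equals the girth, some shortest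
    cycle [c] is such that every vertex has a neighbour on [c]
    ([DOM_or_dom_eq_girth]).

    An ear of length [k] on a shortest cycle splits it into two arcs; each arc
    closes up with the ear, and the two cycles obtained have total length
    [girth + 2 k], so [girth <= 2 k] ([ear_girth]).  With girth at least 7,
    ears of length 1, 2 and 3 are excluded: [c] has no chord, a vertex off [c]
    has a single neighbour on [c], and two vertices off [c] are not adjacent.
    The graph is thus [c] with pendant vertices attached
    ([dominating_cycle_leafy]), a shape recorded by [leafy_cycle].

    Conversely, in a leafy cycle [c] every arc starts on [c], because a pendant
    vertex uses its only edge as an incoming arc.  A total dominating
    set then selects for each vertex of [c] an in-neighbour on [c].  The
    selection is injective, since a vertex with both its cycle neighbours as
    out-neighbours would have no in-neighbour left.  So [gamma_t] is the length
    of [c] for every valid orientation ([leafy_cycle_gamma_t]).  Orienting [c]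
    cyclically and the other edges outwards gives a valid orientation, and both
    [DOM_t] and [dom_t] equal the girth.  The rest of the proof identifies leafy
    cycles with the graphs isomorphic to a standard cycle with leaves appended,
    and shows that they have a single cycle. *)

Set Implicit Arguments.
Unset Strict Implicit.
Unset Printing Implicit Defensive.

(** * Extrema over finite families *)

Lemma bigmin_leq (I : finType) (P : pred I) (F : I -> nat) (m : nat) (i : I) :
  P i -> \big[minn/m]_(j | P j) F j <= F i.
Proof.
move=> Pi; have: i \in index_enum I by rewrite mem_index_enum.
elim: (index_enum I) => // j r IH; rewrite inE big_cons => /orP[/eqP <-|/IH le].
  by rewrite Pi geq_minl.
by case: (P j) => //; rewrite geq_min le orbT.
Qed.

Lemma bigmin_attained (I : finType) (P : pred I) (F : I -> nat) (m : nat) :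
  \big[minn/m]_(j | P j) F j = m \/
  exists2 i, P i & \big[minn/m]_(j | P j) F j = F i.
Proof.
elim/big_ind: _ => [|x y Kx Ky|i Pi]; [by left | | by right; exists i].
by rewrite /minn; case: ifP.
Qed.

Lemma bigmax_attained (I : finType) (P : pred I) (F : I -> nat) :
  0 < \max_(j | P j) F j -> exists2 i, P i & \max_(j | P j) F j = F i.
Proof.
elim/big_ind: _ => [//|x y Kx Ky|i Pi _]; last by exists i.
by rewrite /maxn; case: ifP => //.
Qed.

(** * Successors on a cyclic sequence *)

Lemma next_next_neq (T : eqType) (c : seq T) (x : T) :
  uniq c -> 2 < size c -> x \in c -> next c (next c x) != x.
Proof.
move=> Uc sz xc; case/rot_to: (xc) => i s def_c.
rewrite -!(next_rot i Uc) def_c.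
move: Uc sz; rewrite -(rot_uniq i) -(size_rot i c) def_c.
case: s {def_c} => [|y [|z s]] //=; rewrite !inE !negb_or.
case/andP=> /and3P[xy xz _] _ _.
by rewrite eqxx [y == x]eq_sym (negPf xy) eqxx eq_sym.
Qed.

Lemma next_enum_ord n (i : 'I_n) : next (enum 'I_n) i = ordS i.
Proof.
apply: val_inj; rewrite -(next_map val_inj (enum_uniq _)) val_enum_ord.
case: n i => [[]|n i] //=.
have lt_i := ltn_ord i; rewrite ltnS in lt_i.
(* Refold the successor that simplification has expanded. *)
rewrite -[LHS]/(next (iota 0 n.+1) i).
rewrite next_nth mem_iota ltnS lt_i.
have -> : index (i : nat) (iota 0 n.+1) = i.
  have := @index_uniq _ 0 i (iota 0 n.+1).
  by rewrite size_iota nth_iota // iota_uniq; apply.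
rewrite /=.
case: (ltngtP i n) lt_i => // [lt_i | ->] _.
  by rewrite nth_iota // modn_small.
by rewrite nth_default ?size_iota // modnn.
Qed.

Section Graph.

Variables (T : finType) (e : rel T).
Hypotheses (e_sym : symmetric e) (e_irr : irreflexive e).

(** * Girth *)

Lemma graph_cycleP c :
  reflect [/\ 2 < size c, cycle e c & uniq c] (graph_cycle e c).
Proof. exact: and3P. Qed.

Lemma girth_leq c : graph_cycle e c -> girth e <= size c.
Proof.
move=> gc; have /graph_cycleP[_ _ Uc] := gc.
have sz : size c < #|T|.+1 by rewrite ltnS -(card_uniqP Uc) max_card.
apply: (@bigmin_leq _ _ _ _ (Ordinal sz)).
by apply/existsP; exists (in_tuple c).
Qed.

Lemma girth_attained : has_graph_cycle e ->
  exists2 c, graph_cycle e c & size c = girth e.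
Proof.
case=> c gc; have := girth_leq gc; rewrite /girth.
case: (bigmin_attained (fun k : 'I_#|T|.+1 =>
    [exists c : k.-tuple T, graph_cycle e c]) val #|T|) => [-> | [k Pk ->] _].
  move=> le; exists c => //; apply/eqP; rewrite eqn_leq le andbT.
  by have /graph_cycleP[_ _ Uc] := gc; rewrite -(card_uniqP Uc) max_card.
by case/existsP: Pk => d gd; exists d; rewrite ?size_tuple.
Qed.

(** * Cycles inside total dominating sets *)

(** Passing from [y] to [f y] can only shrink the set of reachable points, so a
    point that reaches the fewest points is reached back from its image. *)
Lemma periodic_point (f : T -> T) (x : T) : exists y, fcycle f (orbit f y).
Proof.
case: (@arg_minnP _ x xpredT (order f)) => // y _ min_y.
exists y; apply/(orbitPcycle 0 2).
have sub: fconnect f (f y) \subset fconnect f y.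
  by apply/subsetP => z; apply: connect_trans (fconnect1 f y).
have := subset_leqif_card sub; case=> _.
rewrite eqn_leq (subset_leq_card sub) [_ <= _]min_y // => /esym/subsetP; apply.
exact: connect0.
Qed.

Lemma orientationP (D : {set T * T}) :
  reflect (forall u v, if e u v then ((u, v) \in D) != ((v, u) \in D)
                       else (u, v) \notin D) (orientation e D).
Proof.
apply: (iffP forallP) => [oD u v | oD u].
  have /forallP/(_ v) := oD u.
  by case: (e u v) => //; do 2!case: (_ \in _).
apply/forallP => v; have := oD u v.
by case: (e u v) => //; do 2!case: (_ \in _).
Qed.

Lemma orientation_edge D u v : orientation e D -> (u, v) \in D -> e u v.
Proof. by move/orientationP/(_ u v); case: ifP => // _ /negPf->. Qed.

Lemma orientation_asym D u v :
  orientation e D -> (u, v) \in D -> (v, u) \notin D.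
Proof.
move=> oD uv; have /orientationP/(_ u v) := oD.
by rewrite (orientation_edge oD uv) uv; case: (_ \in _).
Qed.

Lemma total_dominating_choice (D : {set T * T}) (S : {set T}) :
  total_dominating D S ->
  exists f : T -> T, forall v, f v \in S /\ (f v, v) \in D.
Proof.
move=> /forallP tS.
suff /fin_all_exists : forall v, exists u, u \in S /\ (u, v) \in D by [].
by move=> v; have /existsP[u /andP[]] := tS v; exists u.
Qed.

(** The cycle is a periodic orbit of a choice of in-neighbours in [S]; it is
    traversed against the arcs. *)
Lemma total_dominating_cycle D S : orientation e D -> 0 < #|T| ->
  total_dominating D S -> exists2 c, graph_cycle e c & {subset c <= S}.
Proof.
move=> oD /card_gt0P[x0 _] /total_dominating_choice[f fP].
have [y cy] := periodic_point f x0.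
have ycy : y \in orbit f y by rewrite -fconnect_orbit connect0.
have ef z : e z (f z).
  by rewrite e_sym; case: (fP z) => _ /(orientation_edge oD).
have ff z : f (f z) != z.
  apply/eqP=> ffz; have [_] := fP (f z); rewrite ffz.
  by have [_ /(orientation_asym oD)/negP] := fP z.
exists (orbit f y); last first.
  move=> z zc; rewrite -(eqP (prev_cycle cy zc)).
  by case: (fP (prev (orbit f y) z)).
apply/graph_cycleP; split; last exact: orbit_uniq.
  move: cy (ff y) (ef y); case: (orbit f y) ycy => [|a [|b [|d s]]] //=.
    by rewrite inE => /eqP<-; rewrite andbT => /eqP->; rewrite e_irr.
  rewrite !inE => /orP[]/eqP->; rewrite /= andbT => /andP[/eqP fa /eqP fb];
  by rewrite ?fa ?fb ?fa eqxx.
by apply: sub_cycle cy => u v /eqP<-.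
Qed.

(** * Dominating shortest cycles *)

Definition dominating_girth_cycle (c : seq T) : Prop :=
  [/\ graph_cycle e c, size c = girth e
    & forall x, exists2 u, u \in c & e u x].

(** A total dominating set of [girth] elements is exhausted by the cycle that
    it contains. *)
Lemma tight_total_dominating_cycle D S : orientation e D -> 0 < #|T| ->
  total_dominating D S -> #|S| = girth e -> exists c, dominating_girth_cycle c.
Proof.
move=> oD T0 tS Sg; have [c gc cS] := total_dominating_cycle oD T0 tS.
have /graph_cycleP[_ _ Uc] := gc.
have szc : size c = girth e.
  apply/eqP; rewrite eqn_leq girth_leq // andbT -Sg -(card_uniqP Uc).
  by apply/subset_leq_card/subsetP.
exists c; split=> // x.
have /existsP[u /andP[uS ux]] := forallP tS x.
have cSE : S \subset c.
  have /subset_leqif_card[_] : c \subset S by apply/subsetP.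
  by rewrite (card_uniqP Uc) szc Sg eqxx => /esym.
by exists u; [apply: (subsetP cSE) | apply: orientation_edge ux].
Qed.

(** When no minimum is attained, [gamma_t] and [dom_t] take the value [#|T|]; if
    that is the girth, a shortest cycle passes through all vertices. *)
Lemma full_cycle_dominates : has_graph_cycle e -> #|T| = girth e ->
  exists c, dominating_girth_cycle c.
Proof.
move=> hc Tg; have [c gc szc] := girth_attained hc.
have /graph_cycleP[_ cc Uc] := gc.
have cT : c =i T.
  by apply/subset_cardP; [rewrite (card_uniqP Uc) szc Tg | apply/subsetP].
exists c; split=> // x; exists (prev c x); first by rewrite mem_prev cT.
by apply: prev_cycle; rewrite ?cT.
Qed.

Lemma gamma_t_eq_girth D : has_graph_cycle e -> orientation e D ->
  gamma_t D = girth e -> exists c, dominating_girth_cycle c.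
Proof.
move=> hc oD; rewrite /gamma_t.
have [-> | [S tS ->]] :=
  bigmin_attained (total_dominating D) (fun S => #|S|) #|T|.
  exact: full_cycle_dominates.
apply: tight_total_dominating_cycle oD _ tS.
by case: hc => -[//|x s] _; apply/card_gt0P; exists x.
Qed.

(** [DOM_t] is attained because it is positive, its default value being 0. *)
Lemma DOM_or_dom_eq_girth : has_graph_cycle e -> 0 < girth e ->
  DOM_t e = girth e \/ dom_t e = girth e -> exists c, dominating_girth_cycle c.
Proof.
move=> hc g0 [DOMg | ].
  have [|D /andP[oD _] DE] :=
      @bigmax_attained _ (valid_orientation e) (@gamma_t T).
    by rewrite -/(DOM_t e) DOMg.
  by apply: (gamma_t_eq_girth hc oD); rewrite -DE.
rewrite /dom_t.
have [-> | [D /andP[oD _] ->]] :=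
    bigmin_attained (valid_orientation e) (@gamma_t T) #|T|.
  exact: full_cycle_dominates.
exact: gamma_t_eq_girth.
Qed.

(** * Ears on a shortest cycle *)

Lemma graph_cycle_catI u v p q :
  uniq (u :: p ++ v :: q) -> path e u (rcons p v) -> path e v (rcons q u) ->
  2 < (size p + size q).+2 -> graph_cycle e (u :: p ++ v :: q).
Proof.
move=> U pp pq sz; apply/graph_cycleP; split=> //.
  by rewrite /= size_cat /= addnS.
by rewrite /= rcons_cat rcons_cons -cat_rcons cat_path pp last_rcons.
Qed.

Lemma path_rev_sym u v q :
  path e u (rcons q v) -> path e v (rcons (rev q) u).
Proof.
have := rev_path e u (rcons q v).
rewrite last_rcons belast_rcons rev_cons => ->.
by under eq_path do rewrite e_sym.
Qed.

(** The ear from [u] to [v] has the vertices of [q] inside it; each of the two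
    arcs of [c] between [u] and [v] forms a cycle with the ear.  For a chord,
    that is [q = [::]], both arcs must have an inner vertex. *)
Lemma ear_girth c u v q : graph_cycle e c -> size c = girth e ->
  u \in c -> v \in c -> u != v ->
  uniq q -> ~~ has (mem c) q -> path e u (rcons q v) ->
  (q = [::] -> v <> next c u /\ u <> next c v) ->
  girth e <= (size q).+1.*2.
Proof.
move=> /graph_cycleP[_ cc Uc] szc uc vc uv Uq qc pq chord.
case/rot_to: uc => i s def_c.
move: cc szc Uc; rewrite -(rot_cycle i) -(size_rot i c) => cc szc Uc.
have vs : v \in s.
  by move: vc; rewrite -(mem_rot i) def_c inE eq_sym (negPf uv).
case/splitPr: vs def_c => p1 p2 def_c.
have {}chord : q = [::] -> p1 <> [::] /\ p2 <> [::].
  case/chord; rewrite -!(next_rot i Uc) def_c => nu nv; split=> p0.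
    by case: nu; rewrite p0 /= eqxx.
  case: nv; move: Uc; rewrite -(rot_uniq i) def_c p0.
  rewrite -[_ :: _]/(rot 1 (v :: u :: p1)).
  by rewrite rot_uniq => U1; rewrite next_rot //= eqxx.
have {}qc : ~~ has (mem (u :: p1 ++ v :: p2)) q.
  by rewrite -def_c (eq_has (mem_rot i c)).
move: Uc; rewrite -(rot_uniq i) def_c => Uc.
move: cc szc; rewrite def_c /= size_cat rcons_cat rcons_cons -cat_rcons.
rewrite cat_path last_rcons /=.
case/andP=> pp1 pp2 szc.
have g1 : girth e <= (size p1 + size q).+2.
  have -> : (size p1 + size q).+2 = size (u :: p1 ++ v :: rev q).
    by rewrite /= size_cat /= size_rev addnS.
  apply/girth_leq/graph_cycle_catI => //; last first.
  - rewrite size_rev; case: (q) (p1) chord => [|? ?] [|? ?] //= []//.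
  - exact: path_rev_sym.
  rewrite -cat_rcons -cat_cons cat_uniq rev_uniq Uq has_rev andbT.
  move: Uc; rewrite -cat_rcons -cat_cons cat_uniq => /andP[-> _].
  apply: contra qc; apply: sub_has => z; rewrite /= !inE -cat_rcons mem_cat.
  by case/orP=> ->; rewrite ?orbT.
have g2 : girth e <= (size q + size p2).+2.
  have -> : (size q + size p2).+2 = size (u :: q ++ v :: p2).
    by rewrite /= size_cat /= addnS.
  apply/girth_leq/graph_cycle_catI => //; last first.
  - case: (q) (p2) chord => [|? ?] [|? ?] //= []//.
  have U2 : uniq (u :: v :: p2).
    by apply: subseq_uniq Uc; rewrite /= eqxx suffix_subseq ?suffix_suffix.
  rewrite -cat1s uniq_catCA cat_uniq Uq U2 andbT has_sym.
  apply: contra qc; apply: sub_has => z; rewrite /= !inE mem_cat inE.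
  by case/or3P=> ->; rewrite ?orbT.
move: szc g1 g2; rewrite -addnn.
by move: (girth e) (size p1) (size p2) (size q) => g a b d; lia.
Qed.

(** * Leafy cycles *)

(** The graph is [c] together with pendant vertices; this description inside
    the graph itself avoids an explicit isomorphism. *)
Definition leafy_cycle (c : seq T) : Prop :=
  [/\ graph_cycle e c,
      {in c &, forall x y, e x y -> y = next c x \/ x = next c y}
    & forall x, x \notin c -> exists2 v, v \in c & forall y, e x y = (y == v)].

(** Each failure yields an ear with at most two inner vertices, given by the
    chord, by a vertex off [c] with two neighbours on [c], or by two adjacent
    vertices off [c] dominated by distinct vertices of [c]; if the same vertex
    of [c] dominates both, there is a triangle. *)
Lemma dominating_cycle_leafy c :
  7 <= girth e -> dominating_girth_cycle c -> leafy_cycle c.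
Proof.
move=> g7 [gc szc domc]; have ear u v q := @ear_girth c u v q gc szc.
split=> // [x y xc yc xy | x xc].
  case: (eqVneq y (next c x)) (eqVneq x (next c y)) => [|/eqP nx].
    by left.
  case=> [|/eqP ny]; first by right.
  have xny : x != y by apply: contraTneq xy => ->; rewrite e_irr.
  have /= := ear x y [::] xc yc xny isT isT; rewrite andbT.
  by move=> /(_ xy (fun _ => conj nx ny)); lia.
have [v vc vx] := domc x; exists v => // y.
apply/idP/eqP => [xy | ->]; last by rewrite e_sym.
apply/eqP/negPn/negP => yv.
have [yc | yc] := boolP (y \in c).
  have /= := ear v y [:: x] vc yc; rewrite eq_sym yv vx xy (negPf xc).
  by case=> //; lia.
have [w wc wy] := domc y.
have xny : x != y by apply: contraTneq xy => ->; rewrite e_irr.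
have [wv | wv] := eqVneq w v.
  have : girth e <= size [:: v; x; y].
    apply: girth_leq; apply/graph_cycleP; split=> //=.
      by rewrite vx xy e_sym -wv wy.
    rewrite !inE negb_or xny [v == y]eq_sym yv !andbT.
    by apply: contraNneq xc => <-.
  by move=> /=; lia.
have /= := ear v w [:: x; y] vc wc; rewrite eq_sym wv vx xy [e y w]e_sym wy.
rewrite (negPf xc) (negPf yc) inE xny.
by case=> //; lia.
Qed.

Lemma leafy_cycle_neighbors c x y : leafy_cycle c -> x \in c -> y \in c ->
  e x y -> y \in [:: next c x; prev c x].
Proof.
move=> [/graph_cycleP[_ _ Uc] chordless _] xc yc /(chordless x y xc yc)[->|->].
  by rewrite mem_head.
by rewrite prev_next // !inE eqxx orbT.
Qed.

Lemma cycle_neighbors c x : graph_cycle e c -> x \in c ->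
  [/\ next c x \in c, prev c x \in c, e x (next c x), e x (prev c x)
    & next c x != prev c x].
Proof.
case/graph_cycleP=> sz cc Uc xc.
have pc : prev c x \in c by rewrite mem_prev.
split=> //; first by rewrite mem_next.
- exact: next_cycle.
- by rewrite e_sym prev_cycle.
- by rewrite -{1}(next_prev Uc x) next_next_neq.
Qed.

(** A vertex of any cycle [d] has two distinct neighbours, a pendant vertex only
    one. *)
Lemma leafy_cycle_sub c d : leafy_cycle c -> graph_cycle e d -> {subset d <= c}.
Proof.
move=> [_ _ leaf] gd x xd; apply/negPn/negP => /leaf[v vc ev].
have [_ _] := cycle_neighbors gd xd.
by rewrite !ev => /eqP-> /eqP->; rewrite eqxx.
Qed.

(** The two cycle neighbours on [d] lie on [c], so they are the only two
    candidates that chordlessness leaves, possibly in reverse order. *)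
Lemma leafy_cycle_next_prev c d x :
  leafy_cycle c -> graph_cycle e d -> x \in d ->
  [:: next d x; prev d x] =i [:: next c x; prev c x].
Proof.
move=> lc gd xd; have sub := leafy_cycle_sub lc gd.
have [nd pd en ep np] := cycle_neighbors gd xd.
have inc y : y \in d -> e x y -> y \in [:: next c x; prev c x].
  by move=> yd; apply: leafy_cycle_neighbors; rewrite ?sub.
have [] // := @uniq_min_size _ [:: next d x; prev d x] [:: next c x; prev c x].
  by rewrite /= inE np.
by move=> y /predU1P[->|/predU1P[->|//]]; apply: inc.
Qed.

(** [d] lies on [c] and is closed under the successor of [c], hence goes all the
    way around [c]. *)
Lemma leafy_cycle_mem c d : leafy_cycle c -> graph_cycle e d -> d =i c.
Proof.
move=> lc gd; have sub := leafy_cycle_sub lc gd.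
have [/graph_cycleP[_ _ Uc] _ _] := lc.
have step x : x \in d -> next c x \in d.
  move=> xd; have [nd pd _ _ _] := cycle_neighbors gd xd.
  have: next c x \in [:: next d x; prev d x].
    by rewrite (leafy_cycle_next_prev lc) // mem_head.
  by rewrite !inE => /orP[]/eqP->.
have [x xd] : exists x, x \in d.
  case/graph_cycleP: gd; case: (d) => // x s _ _ _.
  by exists x; rewrite mem_head.
move=> y; apply/idP/idP=> [/sub // | yc].
have := fconnect_cycle (cycle_next Uc) (sub x xd) y; rewrite yc.
by move/iter_findex<-; elim: (findex _ _ _) => //= n; apply: step.
Qed.

Lemma leafy_cycle_size c d :
  leafy_cycle c -> graph_cycle e d -> size d = size c.
Proof.
move=> lc gd; have [/graph_cycleP[_ _ Uc] _ _] := lc.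
have /graph_cycleP[_ _ Ud] := gd.
by apply/perm_size/uniq_perm/leafy_cycle_mem.
Qed.

Lemma leafy_cycle_girth c : leafy_cycle c -> girth e = size c.
Proof.
move=> lc; have [gc _ _] := lc.
have [|d gd <-] := girth_attained; first by exists c.
exact: leafy_cycle_size.
Qed.

(** Listing each edge from both ends makes membership depend only on unordered
    pairs of neighbours, hence insensitive to the direction of [c]. *)
Lemma cycle_edgesP (c : seq T) (E : {set T}) : uniq c ->
  reflect (exists2 x, x \in c &
             exists2 y, y \in [:: next c x; prev c x] & E = [set x; y])
          (E \in cycle_edges c).
Proof.
move=> Uc; apply: (iffP imsetP) => [[x xc ->] | [x xc [y]]].
  by exists x => //; exists (next c x); rewrite ?mem_head.
rewrite !inE => /orP[]/eqP-> ->; first by exists x.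
by exists (prev c x); rewrite ?inE ?mem_prev // next_prev // setUC.
Qed.

(** Two cycles with the same vertices and, at each of them, the same pair of
    neighbours have the same edges. *)
Lemma leafy_unicyclic c : leafy_cycle c -> unicyclic e.
Proof.
move=> lc; have [gc _ _] := lc; have /graph_cycleP[_ _ Uc] := gc.
exists (cycle_edges c); split=> [|E [d gd ->]]; first by exists c.
have /graph_cycleP[_ _ Ud] := gd.
apply/setP => F; apply/cycle_edgesP/cycle_edgesP => // -[x xc [y yx ->]].
  exists x; rewrite ?(leafy_cycle_mem lc gd) //; exists y => //.
  by rewrite (leafy_cycle_next_prev lc) // (leafy_cycle_mem lc gd).
exists x; rewrite -?(leafy_cycle_mem lc gd) //; exists y => //.
by rewrite -(leafy_cycle_next_prev lc gd).
Qed.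

(** * Orientations of a leafy cycle *)

(** The vertices of [c] form a total dominating set since every arc starts on
    [c]; none is smaller, because the in-neighbours that a total dominating set
    provides for the vertices of [c] are pairwise distinct. *)
Lemma leafy_cycle_gamma_t c D : leafy_cycle c -> valid_orientation e D ->
  gamma_t D = size c.
Proof.
move=> lc /andP[oD /forallP vD].
have [gc _ leaf] := lc; have /graph_cycleP[_ _ Uc] := gc.
have arcE := orientation_edge oD; have arcN := orientation_asym oD.
(* The only edge at a pendant vertex is needed to enter it. *)
have arc_c u v : (u, v) \in D -> u \in c.
  move=> uv; apply/negPn/negP => /leaf[w wc ew].
  have /existsP[z zu] := vD u.
  have := arcE _ _ uv; rewrite ew => /eqP vw.
  have := arcE _ _ zu; rewrite e_sym ew => /eqP zw.
  by have := arcN _ _ uv; rewrite vw -zw zu.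
have lower S : total_dominating D S -> size c <= #|S|.
  move=> /total_dominating_choice[p pP].
  have inj_p : {in c &, injective p}.
    (* If [p x = p y] then [x], [y] and [p (p x)] are three neighbours on [c]
       of [p x], which has only two. *)
    move=> x y xc yc pxy; apply/eqP/negPn/negP => xy.
    have [_ xD] := pP x; have [_ yD] := pP y; rewrite -pxy in yD.
    have vc := arc_c _ _ xD; have [_ uD] := pP (p x).
    have xu : x != p (p x) by apply: contraNneq (arcN _ _ xD) => {1}->.
    have yu : y != p (p x) by apply: contraNneq (arcN _ _ yD) => {1}->.
    have U3 : uniq [:: x; y; p (p x)] by rewrite /= !inE negb_or xy xu yu.
    have ux : e (p x) (p (p x)) by rewrite e_sym arcE.
    have near w : w \in c -> e (p x) w -> w \in [:: next c (p x); prev c (p x)].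
      exact: leafy_cycle_neighbors.
    suff /(uniq_leq_size U3) :
      {subset [:: x; y; p (p x)] <= [:: next c (p x); prev c (p x)]} by [].
    move=> w /predU1P[->|/predU1P[->|/predU1P[->|//]]]; apply: near => //.
    - exact: arcE.
    - exact: arcE.
    - exact: arc_c uD.
  rewrite -(size_map p) -(card_uniqP _) ?map_inj_in_uniq //.
  by apply/subset_leq_card/subsetP => _ /mapP[v _ ->]; case: (pP v).
have tc : total_dominating D [set x in c].
  apply/forallP => v; have /existsP[u uv] := vD v.
  by apply/existsP; exists u; rewrite inE uv (arc_c _ _ uv).
apply/eqP; rewrite eqn_leq; apply/andP; split.
  by rewrite -(card_uniqP Uc) -[#|c|]cardsE; apply: bigmin_leq.
rewrite /gamma_t; have [->|[S tS ->]] :=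
  bigmin_attained (total_dominating D) (fun S => #|S|) #|T|.
  by rewrite -(card_uniqP Uc) max_card.
exact: lower.
Qed.

Lemma leafy_cycle_valid_orientation c : leafy_cycle c ->
  exists D, valid_orientation e D.
Proof.
move=> [gc chordless leaf]; have /graph_cycleP[sz cc Uc] := gc.
(* Around the cycle along [next], and outwards on the pendant edges. *)
exists [set a | e a.1 a.2 & (a.2 \in c) ==> (a.2 == next c a.1)].
apply/andP; split.
  apply/orientationP => u v; rewrite !inE /= [e v u]e_sym.
  case euv: (e u v) => //=.
  have uv : u != v by apply: contraTneq euv => ->; rewrite e_irr.
  have [uc|uc] := boolP (u \in c); have [vc|vc] := boolP (v \in c) => /=.
  - case: (chordless u v uc vc euv) => E; rewrite E eqxx.
      by rewrite [u == _]eq_sym (negPf (next_next_neq Uc sz uc)).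
    by rewrite [v == _]eq_sym (negPf (next_next_neq Uc sz vc)).
  - by rewrite next_nth (negPf vc) (negPf uv).
  - by rewrite next_nth (negPf uc) [v == u]eq_sym (negPf uv).
  - by case/leaf: uc vc => w wc ew; move: euv; rewrite ew => /eqP->; rewrite wc.
apply/forallP => v; apply/existsP; have [vc|vc] := boolP (v \in c).
  exists (prev c v); rewrite inE /= prev_cycle // next_prev // eqxx.
  by rewrite implybT.
have [u uc eu] := leaf v vc.
by exists u; rewrite inE /= e_sym eu eqxx (negPf vc).
Qed.

Lemma leafy_cycle_DOM_dom c : leafy_cycle c ->
  DOM_t e = size c /\ dom_t e = size c.
Proof.
move=> lc; have gD := leafy_cycle_gamma_t lc.
have [D vD] := leafy_cycle_valid_orientation lc.
split.
  apply/eqP; rewrite eqn_leq; apply/andP; split.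
    by apply/bigmax_leqP => D' vD'; rewrite gD.
  by rewrite -(gD D) //; apply: leq_bigmax_cond.
apply/eqP; rewrite eqn_leq; apply/andP; split.
  by rewrite -(gD D) //; apply: bigmin_leq.
rewrite /dom_t; have [->|[D' vD' ->]] :=
  bigmin_attained (valid_orientation e) (@gamma_t T) #|T|.
  have [/graph_cycleP[_ _ Uc] _ _] := lc.
  by rewrite -(card_uniqP Uc) max_card.
by rewrite gD.
Qed.

(** * Leafy cycles and cycles with appended leaves *)

(** The isomorphism is the inverse of the map [g] that sends [i] to the [i]-th
    vertex of [c] and the [k]-th leaf at [i] to the [k]-th pendant vertex at
    that vertex. *)
Lemma leafy_cycle_with_leaves c : leafy_cycle c -> cycle_with_leaves e.
Proof.
move=> lc; have [gc chordless leaf] := lc; have /graph_cycleP[sz cc Uc] := gc.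
have [x0 x0c] : exists x, x \in c.
  by case: (c) sz => // x s _; exists x; rewrite mem_head.
pose v (i : 'I_(size c)) := nth x0 c i.
pose A i := [set x | (x \notin c) && e (v i) x].
pose g (a : 'I_(size c) + {i : 'I_(size c) & 'I_(#|A i|)}) : T :=
  match a with inl i => v i | inr w => enum_val (tagged w) end.
have vc i : v i \in c by rewrite mem_nth.
have inj_v : injective v.
  by move=> i j /eqP; rewrite nth_uniq // => /eqP/val_inj.
have cE : c = [seq v i | i <- enum 'I_(size c)].
  by rewrite (map_comp (nth x0 c) val) val_enum_ord; apply/esym/(mkseq_nth x0).
have next_v i : next c (v i) = v (ordS i).
  by rewrite -next_enum_ord -(next_map inj_v (enum_uniq _)); congr (next _ _).
have v_onto x : x \in c -> exists i, v i = x.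
  move=> xc; exists (Ordinal (etrans (index_mem x c) xc)).
  by rewrite /v nth_index.
have pendant (w : {i : 'I_(size c) & 'I_(#|A i|)}) :
    enum_val (tagged w) \notin c /\ e (v (tag w)) (enum_val (tagged w)).
  by have := enum_valP (tagged w); rewrite inE => /andP[].
have e_pendant (w : {i : 'I_(size c) & 'I_(#|A i|)}) y :
    e (enum_val (tagged w)) y = (y == v (tag w)).
  have [wc ew] := pendant w; have [u uc eu] := leaf _ wc.
  by move: ew; rewrite e_sym !eu => /eqP->.
have inj_g : injective g.
  move=> [i|w] [j|w'] /=; first by move/inj_v->.
  - by move=> E; have [] := pendant w'; rewrite -E vc.
  - by move=> E; have [] := pendant w; rewrite E vc.
  (* A pendant vertex has a single neighbour, which recovers the tag. *)
  move=> E; have /inj_v tE : v (tag w) = v (tag w').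
    by apply/eqP; rewrite -e_pendant -E e_pendant.
  by case: w w' tE E => [i a] [i' b] /= tE; case: _ / tE b => b /enum_val_inj->.
have onto_g x : exists a, g a = x.
  have [/v_onto[i <-]|xc] := boolP (x \in c); first by exists (inl i).
  have [u uc eu] := leaf x xc; have [i vi] := v_onto u uc.
  have xA : x \in A i by rewrite inE xc e_sym eu vi eqxx.
  exists (inr (Tagged (fun i => 'I_#|A i|) (enum_rank_in xA x))).
  by rewrite /= enum_rankK_in.
have [h hK] := fin_all_exists onto_g.
have gK : cancel g h by move=> a; apply: inj_g; rewrite hK.
exists (size c); split=> //; exists (fun i => #|A i|).
exists h; first by exists g.
move=> x y; rewrite -{2}(hK x) -{2}(hK y).
case: (h x) (h y) => [i|w] [j|w'] /=.
- rewrite /cycle_graph -!(inj_eq inj_v) -!next_v.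
  apply/orP/idP => [[]/eqP->|/chordless[]// ->]; rewrite ?eqxx; auto.
    exact: next_cycle.
  by rewrite e_sym next_cycle.
- by rewrite e_sym e_pendant (inj_eq inj_v).
- by rewrite e_pendant (inj_eq inj_v).
- rewrite e_pendant; apply/esym/negbTE; have [+ _] := pendant w'.
  by apply: contraNneq => ->.
Qed.

Lemma cycle_with_leaves_leafy : cycle_with_leaves e -> exists c, leafy_cycle c.
Proof.
move=> [n [n2 [l [f [g fK gK] fe]]]].
have ge : {mono g : a b / append_leaves (@cycle_graph n) l a b >-> e a b}.
  by move=> a b; rewrite -fe !gK.
pose v i := g (inl i); have inj_v : injective v.
  by move=> i j /(can_inj gK)[].
pose c := [seq v i | i <- enum 'I_n].
have next_v i : next c (v i) = v (ordS i).
  by rewrite next_map ?enum_uniq // next_enum_ord.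
have Uc : uniq c by rewrite map_inj_uniq ?enum_uniq.
have v_c i : v i \in c by rewrite map_f ?mem_enum.
exists c; split.
- apply/graph_cycleP; split=> //; first by rewrite size_map size_enum_ord.
  apply: cycle_from_next => // _ /mapP[i _ ->].
  by rewrite next_v ge /= /cycle_graph eqxx.
- move=> _ _ /mapP[i _ ->] /mapP[j _ ->]; rewrite ge /= !next_v.
  by case/orP=> /eqP->; auto.
move=> x; rewrite -(fK x); case: (f x) => [i|w] wc; first by rewrite v_c in wc.
exists (v (tag w)) => // y; rewrite -(fK y) ge (can_eq gK).
by case: (f y).
Qed.

End Graph.

Theorem theorem2p4 (T : finType) (e : rel T)
    (e_sym : symmetric e) (e_irr : irreflexive e)
    (e_conn : connected_graph e) (e_cycle : has_graph_cycle e)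
    (e_girth : 7 <= girth e) :
  (DOM_t e = girth e \/ dom_t e = girth e <->
   DOM_t e = dom_t e /\ dom_t e = girth e) /\
  (DOM_t e = dom_t e /\ dom_t e = girth e <->
   unicyclic e /\ cycle_with_leaves e).
Proof.
have i_leafy : DOM_t e = girth e \/ dom_t e = girth e ->
    exists c, leafy_cycle e c.
  have g0 : 0 < girth e by apply: leq_trans e_girth.
  case/(DOM_or_dom_eq_girth e_sym e_irr e_cycle g0) => c dc.
  by exists c; apply: dominating_cycle_leafy dc.
have leafy_ii : (exists c, leafy_cycle e c) ->
    DOM_t e = dom_t e /\ dom_t e = girth e.
  case=> c lc; have [-> ->] := leafy_cycle_DOM_dom e_sym e_irr lc.
  by rewrite (leafy_cycle_girth e_sym lc).
split; split.
- by move/i_leafy/leafy_ii.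
- by case=> _; right.
- case=> _ domg; have [|c lc] := i_leafy; first by right.
  split; first exact: leafy_unicyclic lc.
  exact: leafy_cycle_with_leaves lc.
- by case=> _ /cycle_with_leaves_leafy/leafy_ii.
Qed.
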